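(* Let $R>1$ and let $u$ be the displacement field on $\Omega\setminus\{(0,0)\}$ described in the context, with linear strains $e_{\alpha\beta}=\frac12(u_{\alpha,\beta}+u_{\beta,\alpha})$. For every constant $k\ge 0$, define on $\Omega\setminus\{(0,0)\}$ the (non-homogeneous) Lamé parameters $$\mu=4\,\frac{r^2+k}{r^2}\cos^2\theta,\qquad \lambda=-4\theta\cot\theta-4\,\frac{r^2+k}{r^2}\cos^2\theta .$$ Then the stress $\sigma_{\alpha\beta}=\lambda e_{\gamma\gamma}\delta_{\alpha\beta}+2\mu e_{\alpha\beta}$ is given by $$\sigma_{11}=-2\Big[2\theta+\frac{r^2+k}{r^2}\sin2\theta\Big],\quad \sigma_{22}=2\Big[-2\theta+\frac{r^2+k}{r^2}\sin2\theta\Big],\quad \sigma_{12}=2\,\frac{r^2+k}{r^2}\cos2\theta,$$ and it satisfies the equilibrium equations with zero body force, $\sigma_{\alpha\beta,\beta}=0$ $(\alpha=1,2)$, so that $u$ is the displacement of an equilibrium state of a non-homogeneous, isotropic, compressible linear plane elastic body. Moreover, if $k$ is chosen sufficiently large (depending on $R$), then $\mu>0$ and $\lambda+2\mu>0$ on $\Omega\setminus\{(0,0)\}$, i.e. the Lamé parameters satisfy the strong ellipticity condition $\mu(\lambda+2\mu)>0$.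
   Context: Fix $R>1$. $\Omega\subset\mathbb{R}^2$ is the lens-shaped region filled by the circles $(x_1-c)^2+x_2^2=c^2$, $1\le c\le R$, which all touch at the origin; each point of $\Omega\setminus\{(0,0)\}$ lies on exactly one of these circles and has $x_1>0$. The vector field $u=(u_1,u_2)$ on $\Omega\setminus\{(0,0)\}$ is $u_1=x_2$, $u_2=\frac{x_2^2-x_1^2}{2x_1}$. Polar coordinates $(r,\theta)$ are based at the origin: $x_1=r\cos\theta$, $x_2=r\sin\theta$, $-\pi/2<\theta<\pi/2$ on $\Omega\setminus\{(0,0)\}$; $\theta\cot\theta$ is understood as $1$ at $\theta=0$. Greek indices range over $1,2$, repeated indices are summed, a subscript comma denotes partial differentiation with respect to the Cartesian coordinates, and $\delta_{\alpha\beta}$ is the Kronecker delta. *)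

(* Defs.v *)
From Stdlib Require Import Reals Lra.
From Coquelicot Require Import Coquelicot.
Open Scope R_scope.

Inductive index := i1 | i2.

Definition sum_index (f : index -> R) : R := f i1 + f i2.

Definition kron (a b : index) : R :=
  match a, b with
  | i1, i1 | i2, i2 => 1
  | _, _ => 0
  end.

(* A scalar field is a total function of the Cartesian coordinates (x1, x2);
   only its values on {x1 > 0}, which is an open set, are relevant below. *)
Definition field := R -> R -> R.

Definition partial (b : index) (f : field) : field := fun x1 x2 =>
  match b with
  | i1 => Derive (fun t => f t x2) x1
  | i2 => Derive (fun t => f x1 t) x2
  end.

(* Derive is total, so existence of the derivative has to be stated apart. *)
Definition ex_partial (b : index) (f : field) (x1 x2 : R) : Prop :=
  match b with
  | i1 => ex_derive (fun t => f t x2) x1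
  | i2 => ex_derive (fun t => f x1 t) x2
  end.

Definition strain (u : index -> field) (a b : index) : field := fun x1 x2 =>
  / 2 * (partial b (u a) x1 x2 + partial a (u b) x1 x2).

Definition stress (lam mu : field) (u : index -> field) (a b : index) : field :=
  fun x1 x2 =>
    lam x1 x2 * sum_index (fun g => strain u g g x1 x2) * kron a b
    + 2 * mu x1 x2 * strain u a b x1 x2.

(* The displacement u is an equilibrium state, with zero body force, of the
   isotropic linear elastic body that occupies D and has the
   position-dependent Lame parameters lam and mu.  The derivatives are those
   of functions defined around D, as D need not be open. *)
Definition equilibrium_state (D : R -> R -> Prop) (lam mu : field)
    (u : index -> field) : Prop :=
  forall x1 x2, D x1 x2 ->
    (forall a b, ex_partial b (u a) x1 x2) /\
    (forall a b, ex_partial b (stress lam mu u a b) x1 x2) /\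
    (forall a, sum_index (fun b => partial b (stress lam mu u a b) x1 x2) = 0).

Definition Omega (Rc x1 x2 : R) : Prop :=
  exists c, 1 <= c <= Rc /\ (x1 - c) ^ 2 + x2 ^ 2 = c ^ 2.

Definition Omega_star (Rc x1 x2 : R) : Prop :=
  Omega Rc x1 x2 /\ (x1, x2) <> (0, 0).

Definition u_disp (a : index) : field := fun x1 x2 =>
  match a with
  | i1 => x2
  | i2 => (x2 ^ 2 - x1 ^ 2) / (2 * x1)
  end.

Definition radius : field := fun x1 x2 => sqrt (x1 ^ 2 + x2 ^ 2).
Definition angle : field := fun x1 x2 => atan (x2 / x1).

Definition theta_cot (t : R) : R :=
  if Req_EM_T t 0 then 1 else t * (cos t / sin t).

Definition mu_lens (k : R) : field := fun x1 x2 =>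
  let r := radius x1 x2 in
  let th := angle x1 x2 in
  4 * ((r ^ 2 + k) / r ^ 2) * cos th ^ 2.

Definition lambda_lens (k : R) : field := fun x1 x2 =>
  let r := radius x1 x2 in
  let th := angle x1 x2 in
  - 4 * theta_cot th - 4 * ((r ^ 2 + k) / r ^ 2) * cos th ^ 2.

Lemma Omega_star_pos Rc x1 x2 : Omega_star Rc x1 x2 -> 0 < x1.
Proof.
intros [[c [[Hc _] H]] Hn].
assert (E : x1 ^ 2 + x2 ^ 2 = 2 * c * x1) by nra.
destruct (Rlt_le_dec 0 x1) as [|Hx]; trivial.
exfalso; apply Hn.
assert (x1 = 0) by nra.
assert (x2 = 0) by nra.
congruence.
Qed.

(* radius and angle are the polar coordinates (r, theta) determined by
   x1 = r cos theta, x2 = r sin theta, r > 0, - PI / 2 < theta < PI / 2. *)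
Lemma polar_unique r th : 0 < r -> - PI / 2 < th < PI / 2 ->
  radius (r * cos th) (r * sin th) = r /\ angle (r * cos th) (r * sin th) = th.
Proof.
intros Hr Ht.
assert (Hc : 0 < cos th) by (apply cos_gt_0; lra).
unfold radius, angle; split.
- replace ((r * cos th) ^ 2 + (r * sin th) ^ 2) with (r ^ 2).
  + apply sqrt_pow2; lra.
  + generalize (sin2_cos2 th); unfold Rsqr; intros E.
    replace ((r * cos th) ^ 2 + (r * sin th) ^ 2)
      with (r ^ 2 * (sin th * sin th + cos th * cos th)) by ring.
    rewrite E; ring.
- replace (r * sin th / (r * cos th)) with (tan th).
  + apply atan_tan; lra.
  + unfold tan; field; lra.
Qed.

Lemma polar_spec x1 x2 : 0 < x1 ->
  0 < radius x1 x2 /\ - PI / 2 < angle x1 x2 < PI / 2 /\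
  x1 = radius x1 x2 * cos (angle x1 x2) /\
  x2 = radius x1 x2 * sin (angle x1 x2).
Proof.
intros Hx.
assert (Hr : 0 < radius x1 x2) by (apply sqrt_lt_R0; nra).
assert (Hs : sqrt (1 + (x2 / x1)²) = radius x1 x2 / x1).
{ unfold radius.
  replace (1 + (x2 / x1)²) with ((x1 ^ 2 + x2 ^ 2) / x1 ^ 2)
    by (unfold Rsqr; field; lra).
  rewrite sqrt_div_alt by nra.
  rewrite (sqrt_pow2 x1) by lra; reflexivity. }
split; [exact Hr|split; [|split]].
- generalize (atan_bound (x2 / x1)); unfold angle; lra.
- unfold angle; rewrite cos_atan, Hs; field; lra.
- unfold angle; rewrite sin_atan, Hs; field; lra.
Qed.

(* Main.v *)
Require Import Defs.
From Stdlib Require Import Reals Lra.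
From Coquelicot Require Import Coquelicot.
Open Scope R_scope.

(** Everything rests on the relations [x1 = r cos theta], [x2 = r sin theta]
    on the half-plane [x1 > 0], which contains the lens without its cusp.

    There the strain is [e11 = 0], [e22 = x2 / x1 = tan theta],
    [e12 = (x1 ^ 2 - x2 ^ 2) / (4 x1 ^ 2)].  Since [e11] vanishes, the trace
    is [tan theta], and the factor [cot theta] in [lambda] is cancelled by it:
    the stress involves only [theta] and rational functions of [x1], [x2]
    ([stress_cartesian]).  It is the stress of the Airy function
    [phi = 2 (k - r ^ 2) theta], that is [sigma11 = phi,22],
    [sigma22 = phi,11], [sigma12 = - phi,12], so its divergence vanishes
    ([airy_stress_divergence_free]).

    For ellipticity, [lambda + 2 mu = 4 (q - theta cot theta)] with
    [q = (r ^ 2 + k) cos theta ^ 2 / r ^ 2].  One has [theta cot theta <= 1],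
    while on the circle of radius [c] through the point [r ^ 2 = 2 c x1], so
    [cos theta ^ 2 / r ^ 2 = 1 / (4 c ^ 2) >= 1 / (4 R ^ 2)].
    Hence [k >= 4 R ^ 2] forces [q > 1] ([lens_cos_factor_gt_1]). *)

(** * Cartesian form of the Lame parameters and of the stress *)

Lemma radius_sqr x1 x2 : radius x1 x2 ^ 2 = x1 ^ 2 + x2 ^ 2.
Proof. unfold radius; apply pow2_sqrt; nra. Qed.

Lemma theta_cot_atan y : theta_cot (atan y) * y = atan y.
Proof.
unfold theta_cot; destruct (Req_EM_T (atan y) 0) as [E|E].
- rewrite <- (tan_atan y) at 1; rewrite E, tan_0; ring.
- assert (Hy : y <> 0) by (intros ->; apply E, atan_0).
  assert (Hs : 0 < sqrt (1 + y²)) by (apply sqrt_lt_R0; unfold Rsqr; nra).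
  rewrite cos_atan, sin_atan; field; lra.
Qed.

(** The common factor of the two parameters,
    [(r ^ 2 + k) cos theta ^ 2 / r ^ 2], in Cartesian coordinates. *)
Lemma cos_factor_cartesian k x1 x2 : 0 < x1 ->
  (radius x1 x2 ^ 2 + k) / radius x1 x2 ^ 2 * cos (angle x1 x2) ^ 2 =
  (x1 ^ 2 + x2 ^ 2 + k) * x1 ^ 2 / (x1 ^ 2 + x2 ^ 2) ^ 2.
Proof.
intros Hx; destruct (polar_spec x1 x2 Hx) as (Hr & _ & E1 & _).
rewrite <- radius_sqr.
apply (f_equal (fun t => t ^ 2)) in E1; rewrite E1.
field; lra.
Qed.

Lemma strain_11 x1 x2 : strain u_disp i1 i1 x1 x2 = 0.
Proof. unfold strain, partial, u_disp; rewrite Derive_const; field. Qed.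

Lemma partial_1_u2 x1 x2 : 0 < x1 ->
  partial i1 (u_disp i2) x1 x2 = - (x1 ^ 2 + x2 ^ 2) / (2 * x1 ^ 2).
Proof.
intros Hx; apply is_derive_unique; unfold u_disp; auto_derive; [lra|field; lra].
Qed.

Lemma partial_2_u2 x1 x2 : 0 < x1 ->
  partial i2 (u_disp i2) x1 x2 = x2 / x1.
Proof.
intros Hx; apply is_derive_unique; unfold u_disp; auto_derive; [lra|field; lra].
Qed.

Lemma strain_22 x1 x2 : 0 < x1 -> strain u_disp i2 i2 x1 x2 = x2 / x1.
Proof.
intros Hx; unfold strain; rewrite (partial_2_u2 _ _ Hx); field; lra.
Qed.

Lemma strain_sym u a b x1 x2 : strain u a b x1 x2 = strain u b a x1 x2.
Proof. unfold strain; ring. Qed.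

Lemma strain_12 x1 x2 : 0 < x1 ->
  strain u_disp i1 i2 x1 x2 = (x1 ^ 2 - x2 ^ 2) / (4 * x1 ^ 2).
Proof.
intros Hx; unfold strain; rewrite (partial_1_u2 _ _ Hx).
unfold partial, u_disp; rewrite Derive_id; field; lra.
Qed.

(** The stress tensor of the Airy function
    [2 (k - (x1 ^ 2 + x2 ^ 2)) atan (x2 / x1)]. *)
Definition airy_stress (k : R) (a b : index) : field := fun x1 x2 =>
  let s := x1 ^ 2 + x2 ^ 2 in
  match a, b with
  | i1, i1 => - 4 * atan (x2 / x1) - 4 * (x1 * x2) * (s + k) / s ^ 2
  | i2, i2 => - 4 * atan (x2 / x1) + 4 * (x1 * x2) * (s + k) / s ^ 2
  | _, _ => 2 * (x1 ^ 2 - x2 ^ 2) * (s + k) / s ^ 2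
  end.

(** The term [theta cot theta] of [lambda] is only ever multiplied by the
    trace [tan theta], which leaves [theta], also when [theta = 0]. *)
Lemma stress_cartesian k a b x1 x2 : 0 < x1 ->
  stress (lambda_lens k) (mu_lens k) u_disp a b x1 x2 = airy_stress k a b x1 x2.
Proof.
intros Hx.
assert (Hs : x1 ^ 2 + x2 ^ 2 <> 0) by nra.
generalize (theta_cot_atan (x2 / x1)); intros Ht.
unfold stress, sum_index, lambda_lens, mu_lens; cbv zeta.
rewrite (Rmult_assoc 4), (cos_factor_cartesian k x1 x2 Hx).
fold (angle x1 x2) in Ht.
destruct a, b; unfold kron, airy_stress; cbv zeta; fold (angle x1 x2);
  rewrite ?strain_11, ?(strain_22 _ _ Hx), ?(strain_sym _ i2 i1),
    ?(strain_12 _ _ Hx);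
  revert Ht; generalize (theta_cot (angle x1 x2)); generalize (angle x1 x2);
  intros th T <-; field; lra.
Qed.

Lemma airy_stress_polar k x1 x2 : 0 < x1 ->
  let r := radius x1 x2 in
  let th := angle x1 x2 in
  airy_stress k i1 i1 x1 x2
    = - 2 * (2 * th + (r ^ 2 + k) / r ^ 2 * sin (2 * th)) /\
  airy_stress k i2 i2 x1 x2
    = 2 * (- 2 * th + (r ^ 2 + k) / r ^ 2 * sin (2 * th)) /\
  airy_stress k i1 i2 x1 x2
    = 2 * ((r ^ 2 + k) / r ^ 2) * cos (2 * th).
Proof.
intros Hx r th; destruct (polar_spec x1 x2 Hx) as (Hr & _ & E1 & E2).
fold r th in Hr, E1, E2.
unfold airy_stress; cbv zeta; fold (angle x1 x2); fold th.
rewrite <- (radius_sqr x1 x2); fold r.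
rewrite sin_2a, cos_2a.
rewrite E1, E2.
repeat split; field; lra.
Qed.

(** * Equilibrium *)

(** Partial derivatives at a point of the open half-plane [x1 > 0] depend only
    on the values there. *)
Lemma locally_halfplane (f g : field) b x1 x2 : 0 < x1 ->
  (forall y1 y2, 0 < y1 -> f y1 y2 = g y1 y2) ->
  (ex_partial b g x1 x2 -> ex_partial b f x1 x2) /\
  partial b f x1 x2 = partial b g x1 x2.
Proof.
intros Hx E.
assert (L : locally x1 (fun t => f t x2 = g t x2)).
{ exists (mkposreal _ Hx); intros y Hy; apply E.
  apply Rabs_lt_between' in Hy; simpl in Hy; lra. }
destruct b; unfold ex_partial, partial; split.
- apply ex_derive_ext_loc; revert L; apply filter_imp; auto.
- apply Derive_ext_loc, L.
- apply ex_derive_ext; intros t; symmetry; auto.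
- apply Derive_ext; auto.
Qed.

Lemma ex_partial_u_disp a b x1 x2 : 0 < x1 -> ex_partial b (u_disp a) x1 x2.
Proof.
intros Hx; destruct a, b; unfold ex_partial, u_disp; auto_derive; lra || trivial.
Qed.

(** Side conditions left by differentiating quotients by [x1] and by powers of
    [x1 ^ 2 + x2 ^ 2]. *)
Ltac halfplane_nonzero :=
  repeat split; try apply Rgt_not_eq; unfold Rgt; trivial; try lra; nra.

Lemma airy_stress_ex_partial k a b c x1 x2 : 0 < x1 ->
  ex_partial c (airy_stress k a b) x1 x2.
Proof.
intros Hx.
assert (Hs : 0 < x1 ^ 2 + x2 ^ 2) by nra.
assert (Hss : 0 < (x1 ^ 2 + x2 ^ 2) ^ 2) by (apply pow_lt, Hs).
destruct a, b, c; unfold ex_partial, airy_stress; cbv zeta;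
  auto_derive; halfplane_nonzero.
Qed.


Lemma airy_stress_divergence_free k a x1 x2 : 0 < x1 ->
  sum_index (fun b => partial b (airy_stress k a b) x1 x2) = 0.
Proof.
intros Hx.
assert (Hs : 0 < x1 ^ 2 + x2 ^ 2) by nra.
assert (Hss : 0 < (x1 ^ 2 + x2 ^ 2) ^ 2) by (apply pow_lt, Hs).
set (s := x1 ^ 2 + x2 ^ 2).
(* d1 = phi,122 and d2 = phi,112 for the Airy function phi. *)
set (d1 := 4 * x2 / s - 4 * (x2 * (s + k) / s ^ 2
  + 2 * x1 ^ 2 * x2 / s ^ 2 - 4 * x1 ^ 2 * x2 * (s + k) / s ^ 3)).
set (d2 := - 4 * x1 / s + 4 * (x1 * (s + k) / s ^ 2
  + 2 * x1 * x2 ^ 2 / s ^ 2 - 4 * x1 * x2 ^ 2 * (s + k) / s ^ 3)).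
assert (E11 : partial i1 (airy_stress k i1 i1) x1 x2 = d1).
{ apply is_derive_unique; unfold airy_stress; cbv zeta.
  auto_derive; [halfplane_nonzero|unfold d1, s; field; halfplane_nonzero]. }
assert (E12 : partial i2 (airy_stress k i1 i2) x1 x2 = - d1).
{ apply is_derive_unique; unfold airy_stress; cbv zeta.
  auto_derive; [halfplane_nonzero|unfold d1, s; field; halfplane_nonzero]. }
assert (E21 : partial i1 (airy_stress k i2 i1) x1 x2 = - d2).
{ apply is_derive_unique; unfold airy_stress; cbv zeta.
  auto_derive; [halfplane_nonzero|unfold d2, s; field; halfplane_nonzero]. }
assert (E22 : partial i2 (airy_stress k i2 i2) x1 x2 = d2).
{ apply is_derive_unique; unfold airy_stress; cbv zeta.
  auto_derive; [halfplane_nonzero|unfold d2, s; field; halfplane_nonzero]. }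
unfold sum_index; destruct a; rewrite ?E11, ?E12, ?E21, ?E22; ring.
Qed.

(** * Strong ellipticity *)

(** By the mean value theorem [atan y = y / (1 + c ^ 2)] for some [c], so for
    [y <> 0] the factor in [atan y = theta_cot (atan y) * y] is
    [/ (1 + c ^ 2)]. *)
Lemma theta_cot_atan_le_1 y : theta_cot (atan y) <= 1.
Proof.
destruct (Req_dec y 0) as [->|Hy].
- unfold theta_cot; rewrite atan_0; destruct (Req_EM_T 0 0); lra.
- destruct (MVT_gen atan 0 y (fun t => / (1 + t ^ 2))) as (c & _ & Hc).
  + intros t _; auto_derive; [trivial|field; nra].
  + intros t _; apply derivable_continuous_pt, derivable_pt_atan.
  + rewrite atan_0, !Rminus_0_r, <- theta_cot_atan in Hc.
    apply Rmult_eq_reg_r in Hc; [rewrite Hc|exact Hy].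
    rewrite <- Rinv_1; apply Rinv_le_contravar; nra.
Qed.

Lemma lens_cos_factor_gt_1 Rc k x1 x2 : Omega_star Rc x1 x2 -> 4 * Rc ^ 2 <= k ->
  1 < (x1 ^ 2 + x2 ^ 2 + k) * x1 ^ 2 / (x1 ^ 2 + x2 ^ 2) ^ 2.
Proof.
intros H Hk; generalize (Omega_star_pos _ _ _ H); intros Hx.
destruct H as [[c [[Hc1 Hc2] Hc]] _].
assert (E : x1 ^ 2 + x2 ^ 2 = 2 * c * x1) by nra.
assert (Hp : 0 < c * x1) by (apply Rmult_lt_0_compat; lra).
(* The circle equation turns the quotient into (r ^ 2 + k) / (4 c ^ 2). *)
rewrite E.
replace ((2 * c * x1 + k) * x1 ^ 2 / (2 * c * x1) ^ 2)
  with ((2 * (c * x1) + k) / (4 * c ^ 2)) by (field; lra).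
apply Rlt_div_r; nra.
Qed.

Theorem mainTheorem3 :
  forall Rc : R, 1 < Rc ->
  (forall k : R, 0 <= k ->
     (forall x1 x2 : R, Omega_star Rc x1 x2 ->
        let r := radius x1 x2 in
        let th := angle x1 x2 in
        let sigma := fun a b => stress (lambda_lens k) (mu_lens k) u_disp a b x1 x2 in
        sigma i1 i1 = - 2 * (2 * th + (r ^ 2 + k) / r ^ 2 * sin (2 * th)) /\
        sigma i2 i2 = 2 * (- 2 * th + (r ^ 2 + k) / r ^ 2 * sin (2 * th)) /\
        sigma i1 i2 = 2 * ((r ^ 2 + k) / r ^ 2) * cos (2 * th)) /\
     equilibrium_state (Omega_star Rc) (lambda_lens k) (mu_lens k) u_disp) /\
  (exists K : R, 0 <= K /\
     forall k : R, K <= k ->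
     forall x1 x2 : R, Omega_star Rc x1 x2 ->
       0 < mu_lens k x1 x2 /\
       0 < lambda_lens k x1 x2 + 2 * mu_lens k x1 x2 /\
       0 < mu_lens k x1 x2 * (lambda_lens k x1 x2 + 2 * mu_lens k x1 x2)).
Proof.
intros Rc HR; split.
- intros k _; split.
  + intros x1 x2 H r th; cbv zeta.
    generalize (Omega_star_pos _ _ _ H); intros Hx.
    rewrite !stress_cartesian by exact Hx.
    exact (airy_stress_polar k x1 x2 Hx).
  + intros x1 x2 H.
    generalize (Omega_star_pos _ _ _ H); intros Hx.
    assert (T : forall a b c,
      (ex_partial c (airy_stress k a b) x1 x2 ->
       ex_partial c (stress (lambda_lens k) (mu_lens k) u_disp a b) x1 x2) /\
      partial c (stress (lambda_lens k) (mu_lens k) u_disp a b) x1 x2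
        = partial c (airy_stress k a b) x1 x2).
    { intros a b c; apply locally_halfplane; [exact Hx|].
      intros y1 y2; apply stress_cartesian. }
    split; [|split].
    * intros a b; apply ex_partial_u_disp, Hx.
    * intros a b; apply T, airy_stress_ex_partial, Hx.
    * intros a; rewrite <- (airy_stress_divergence_free k a x1 x2 Hx).
      unfold sum_index; f_equal; apply T.
- exists (4 * Rc ^ 2); split; [nra|].
  intros k Hk x1 x2 H.
  generalize (Omega_star_pos _ _ _ H); intros Hx.
  generalize (lens_cos_factor_gt_1 _ _ _ _ H Hk); intros Hq.
  generalize (theta_cot_atan_le_1 (x2 / x1)); fold (angle x1 x2); intros Ht.
  unfold lambda_lens, mu_lens; cbv zeta.
  rewrite (Rmult_assoc 4), (cos_factor_cartesian k x1 x2 Hx).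
  split; [lra|split; [lra|apply Rmult_lt_0_compat; lra]].
Qed.
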